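(* Let $c\ge1$ and $t\ge1$, and let $(G,N)$ be a pair of finite groups that is nilpotent of class $t$. Then: (i) (a) If $t\ge c+1$, then $|[N,\,_{t-1}G]|\,|M^{(c)}(G,N)|$ divides $$\left|M^{(c)}\!\left(\frac{G}{[N,\,_{t-1}G]},\frac{N}{[N,\,_{t-1}G]}\right)\right|\;\left|\otimes^{c+1}\!\left([N,\,_{t-1}G],\frac{G}{Z_{t-1}(N,G)}\right)\right|;$$ (b) If $t<c+1$, then $|[N,\,_{c}G]|\,|M^{(c)}(G,N)|$ divides $$\left|M^{(c)}\!\left(\frac{G}{[N,\,_{t-1}G]},\frac{N}{[N,\,_{t-1}G]}\right)\right|\;\left|\otimes^{c+1}\!\left([N,\,_{t-1}G],\frac{G}{Z_{t-1}(N,G)}\right)\right|;$$ (ii) $\displaystyle d(M^{(c)}(G,N))\le d\!\left(M^{(c)}\!\left(\frac{G}{[N,\,_{t-1}G]},\frac{N}{[N,\,_{t-1}G]}\right)\right)+d\!\left(\otimes^{c+1}\!\left([N,\,_{t-1}G],\frac{G}{Z_{t-1}(N,G)}\right)\right)$; (iii) $\displaystyle \exp(M^{(c)}(G,N))\le \exp\!\left(M^{(c)}\!\left(\frac{G}{[N,\,_{t-1}G]},\frac{N}{[N,\,_{t-1}G]}\right)\right)\exp\!\left(\otimes^{c+1}\!\left([N,\,_{t-1}G],\frac{G}{Z_{t-1}(N,G)}\right)\right)$.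
   Context: A pair of groups $(G,N)$ is a group $G$ with a normal subgroup $N$. Commutators are left-normed: $[X,\,_0F]=X$ and $[X,\,_{k+1}F]=[[X,\,_kF],F]$. For a pair $(G,N)$ and $c\ge1$, take a free presentation $1\to R\to F\to G\to 1$ ($F$ free) and let $S\le F$ be the preimage of $N$, so that $N\cong S/R$. The $c$-nilpotent multiplier of the pair is $$M^{(c)}(G,N)=\frac{R\cap[S,\,_cF]}{[R,\,_cF]}.$$ The upper central series of the pair $(G,N)$ is defined by $Z_0(N,G)=1$ and $Z_{i+1}(N,G)=\{x\in N: [x,g]\in Z_i(N,G)\text{ for all }g\in G\}$. The pair $(G,N)$ is nilpotent of class $t$ if $[N,\,_tG]=1$ and $[N,\,_{t-1}G]\neq1$ (equivalently, $t$ is the least integer with $Z_t(N,G)=N$). $\otimes^{c+1}(B,Q)=B\otimes Q\otimes\cdots\otimes Q$ with $c$ copies of $Q$, where the tensor product of groups is the tensor product over $\mathbf{Z}$ of their abelianizations. $d(X)$ is the minimal number of generators of the group $X$ and $\exp(X)$ is its exponent. *)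

(* Defs.v *)
From HB Require Import structures.
From mathcomp Require Import all_boot all_order all_algebra all_fingroup.
From mathcomp Require Import all_solvable.
From mathcomp Require Import boolp classical_sets.
Set Implicit Arguments.
Unset Strict Implicit.
Unset Printing Implicit Defensive.
Import GroupScope.

(* Arbitrary groups are of type [groupType] and their subgroups are Prop-valued
   sets (classical_sets); finite groups are those of fingroup. *)

Section PossiblyInfiniteGroups.
Variable F : groupType.
Implicit Types A B X : set F.
Local Open Scope classical_set_scope.

Definition subgroup_set A : Prop :=
  [/\ A 1, forall x y, A x -> A y -> A (x * y) & forall x, A x -> A x^-1].

Definition gen_set A : set F := smallest subgroup_set A.

Definition comm_set A B : set F := gen_set [set [~ x, y] | x in A & y in B].

Definition lcomm_set X (k : nat) : set F :=
  iter k (fun Y => comm_set Y [set: F]) X.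

(* F is free on some basis i : X -> F. *)
Definition free_group : Prop :=
  exists (X : Type) (i : X -> F),
    forall (H : groupType) (f : X -> H),
      (exists phi : {multiplicative F -> H}, forall x, phi (i x) = f x) /\
      (forall phi psi : {multiplicative F -> H},
         (forall x, phi (i x) = psi (i x)) -> phi =1 psi).

(* The finite group M is isomorphic to A / B, where B is a normal subgroup of
   the subgroup A of F: phi is an epimorphism from A onto M with kernel B. *)
Definition isog_section A B (mT : finGroupType) (M : {group mT}) : Prop :=
  exists phi : F -> mT,
    [/\ forall x y, A x -> A y -> phi (x * y) = phi x * phi y,
        phi @` A = [set` M]
      & [set x | A x /\ phi x = 1] = B].

End PossiblyInfiniteGroups.

(* A presentation 1 -> R -> F -> G -> 1, where R is the kernel of fp_map. *)
Record free_presentation (gT : finGroupType) (G : {group gT}) := FreePresentation {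
  fp_group : groupType;
  fp_map : {multiplicative fp_group -> gT};
  fp_free : free_group fp_group;
  fp_onto : range fp_map = [set` G]%classic }.

Section PairMultiplier.
Variables (gT : finGroupType) (G : {group gT}) (P : free_presentation G).
Local Open Scope classical_set_scope.

Definition fp_ker : set (fp_group P) := [set x | fp_map P x = 1].

Definition fp_preim (N : {group gT}) : set (fp_group P) :=
  fp_map P @^-1` [set` N].

Definition is_multiplier (c : nat) (N : {group gT})
    (mT : finGroupType) (M : {group mT}) : Prop :=
  isog_section (fp_ker `&` lcomm_set (fp_preim N) c) (lcomm_set fp_ker c) M.

End PairMultiplier.

Section FinitePairs.
Variable gT : finGroupType.
Implicit Types G N : {group gT}.

Definition lcomm N G (k : nat) : {group gT} :=
  iter k (fun X : {group gT} => [~: X, G]%G) N.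

Fixpoint pair_ucn N G (i : nat) : {set gT} :=
  if i is j.+1 then
    [set x in N | [forall g in G, [~ x, g] \in pair_ucn N G j]]
  else 1.

(* [coset_of Z] is a quotient by <<Z>> for an arbitrary set Z; here Z = <<Z>>. *)
Lemma pair_ucn_group N G i : N <| G ->
  group_set (pair_ucn N G i) /\ G \subset 'N(pair_ucn N G i).
Proof.
move=> /andP[sNG nNG]; elim: i => [|i [gZ nZ]] /=.
  by rewrite groupP norms1.
pose Z := Group gZ; split.
  apply/group_setP; split.
    rewrite inE group1; apply/forall_inP => g _.
    by rewrite comm1g; apply: (group1 Z).
  move=> x y /setIdP[Nx /forall_inP Zx] /setIdP[Ny /forall_inP Zy].
  rewrite inE groupM //; apply/forall_inP => g Gg.
  rewrite commMgJ; apply: (groupM (G := Z)); last exact: Zy.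
  by rewrite memJ_norm ?Zx // (fintype.subsetP nZ) // (fintype.subsetP sNG).
apply/fintype.subsetP => h Gh; rewrite inE; apply/fintype.subsetP => _ /imsetP[x Zx ->].
case/setIdP: Zx => Nx /forall_inP Zx.
rewrite inE memJ_norm ?(fintype.subsetP nNG) // Nx /=; apply/forall_inP => g Gg.
rewrite -(conjgKV h g) -conjRg memJ_norm ?(fintype.subsetP nZ) //.
by apply: Zx; rewrite groupJ ?groupV.
Qed.

Definition nilpotent_pair_of_class N G (t : nat) : Prop :=
  lcomm N G t :=: 1 /\ lcomm N G t.-1 :<>: 1.

End FinitePairs.

Section TensorProduct.
Import GRing.Theory.

Definition biadditive (aT bT : finGroupType) (A : {group aT}) (B : {group bT})
    (V : zmodType) (f : aT -> bT -> V) : Prop :=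
  {in A &, forall a a', {in B, forall b, f (a * a') b = (f a b + f a' b)%R}} /\
  {in B &, forall b b', {in A, forall a, f a (b * b') = (f a b + f a b')%R}}.

(* The abelian group T is the tensor product over Z of the abelian groups A and
   B: it carries a universal biadditive map tau. *)
Definition is_tensorZ (aT bT uT : finGroupType)
    (A : {group aT}) (B : {group bT}) (T : {group uT}) : Prop :=
  abelian T /\
  exists tau : aT -> bT -> uT,
    [/\ {in A & B, forall a b, tau a b \in T},
        {in A &, forall a a', {in B, forall b, tau (a * a') b = tau a b * tau a' b}},
        {in B &, forall b b', {in A, forall a, tau a (b * b') = tau a b * tau a b'}}
      & forall (V : zmodType) (f : aT -> bT -> V), biadditive A B f ->
        (exists phi : uT -> V,
           {in T &, forall x y, phi (x * y) = (phi x + phi y)%R} /\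
           {in A & B, forall a b, phi (tau a b) = f a b}) /\
        (forall phi psi : uT -> V,
           {in T &, forall x y, phi (x * y) = (phi x + phi y)%R} ->
           {in T &, forall x y, psi (x * y) = (psi x + psi y)%R} ->
           {in A & B, forall a b, phi (tau a b) = psi (tau a b)} ->
           {in T, phi =1 psi})].

Definition is_tensor (aT bT uT : finGroupType)
    (A : {group aT}) (B : {group bT}) (T : {group uT}) : Prop :=
  is_tensorZ (A / [~: A, A])%G (B / [~: B, B])%G T.

(* T is B (x) Q (x) ... (x) Q with k copies of Q, bracketed to the left. *)
Fixpoint is_tensor_power (bT qT : finGroupType) (B : {group bT}) (Q : {group qT})
    (k : nat) (uT : finGroupType) (T : {group uT}) : Prop :=
  if k is j.+1 then
    exists (vT : finGroupType) (U : {group vT}),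
      is_tensor_power B Q j U /\ is_tensor U Q T
  else B \isog T.

End TensorProduct.

(* Main.v *)
(* Let R and L be the preimages in F of 1 and of K = [N, _(t-1) G], and S that of
   N. Since K is central in G, [L, F] <= R, so that
     [R, _c F] <= [L, _c F] <= R :&: [S, _c F] <= L :&: [S, _c F].
   Modulo [R, _c F] the third term is M^(c)(G, N); modulo [L, _c F] the fourth
   one is M^(c)(G / K, N / K); and the quotient of the fourth by the third is
   K :&: [N, _c G], that is K if c < t and [N, _c G] = 1 otherwise. It remains
   to see that [L, _c F] / [R, _c F] is an epimorphic image of the tensor product.
   For each i the commutator induces a map
     [L, _i F] / [R, _i F] x F -> [L, _(i+1) F] / [R, _(i+1) F]
   which is biadditive because these sections are central, and by the three
   subgroups lemma it vanishes on the preimage of Z_(t-1)(N, G) in the second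
   argument.

   Finiteness of [S, _c F] / [R, _c F] comes from the same pairing, applied to
   the consecutive terms of the chain of preimages of the [N, _j G]. Two lifts
   F1 -> F2 of the identity of G agree on [S, _c F1] modulo [R, _c F2], hence
   the multiplier does not depend on the presentation. *)

Require Import Defs.
From HB Require Import structures.
From mathcomp Require Import all_boot all_order all_algebra all_fingroup.
From mathcomp Require Import all_solvable.
From mathcomp Require Import boolp classical_sets.
Import GroupScope.

Set Implicit Arguments.
Unset Strict Implicit.
Unset Printing Implicit Defensive.

(** * Commutator calculus of normal subgroups *)

Section SubgroupSets.
Variable F : groupType.
Implicit Types A B C D X Y : set F.
Local Open Scope classical_set_scope.

Definition normal_set A := subgroup_set A /\ forall x y, A x -> A (x ^ y).

Section NormalSet.
Variables (A : set F) (nA : normal_set A).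

Lemma nset_subgroup : subgroup_set A. Proof. by case: nA. Qed.
Lemma nset1 : A 1. Proof. by case: nset_subgroup. Qed.
Lemma nsetM x y : A x -> A y -> A (x * y).
Proof. by case: nset_subgroup => _ + _; apply. Qed.
Lemma nsetV x : A x -> A x^-1. Proof. by case: nset_subgroup => _ _; apply. Qed.
Lemma nsetJ x y : A x -> A (x ^ y). Proof. by case: nA => _; apply. Qed.
Lemma nsetVE x : A x^-1 -> A x. Proof. by move/nsetV; rewrite invgK. Qed.

Lemma nset_commL x y : A x -> A [~ x, y].
Proof. by move=> Ax; rewrite commgEl; apply: nsetM; [apply: nsetV | apply: nsetJ]. Qed.

Lemma nset_commC x y : A [~ x, y] -> A [~ y, x].
Proof. by move/nsetV; rewrite invgR. Qed.

End NormalSet.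

Lemma commMg_conj (x y z : F) : [~ x * y, z] = [~ x, z] ^ y * [~ y, z].
Proof. by rewrite !commgEr conjgM mulgA -conjMg mulgK. Qed.

Lemma commgM_conj (x y z : F) : [~ x, y * z] = [~ x, z] * [~ x, y] ^ z.
Proof. by rewrite !commgEl conjgM -mulgA -conjMg mulVKg. Qed.

Lemma commVg_conj (x z : F) : [~ x^-1, z] = [~ x, z]^-1 ^ x^-1.
Proof.
have := commMg_conj x x^-1 z; rewrite mulgV comm1g => /esym/eqP.
by rewrite mulg_eq1 conjVg => /eqP->; rewrite invgK.
Qed.

Lemma Hall_Witt (x y z : F) :
  [~ x, y^-1, z] ^ y * [~ y, z^-1, x] ^ z * [~ z, x^-1, y] ^ x = 1.
Proof.
rewrite !commgEl !conjgE !invgM !invgK !mulgA.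
by rewrite !(mulgVK, mulgK, mulgV, mulVg, mul1g, mulg1).
Qed.

Lemma gen_set_subgroup X : subgroup_set (gen_set X).
Proof.
split=> [A [[A1 _ _] _] // | x y gx gy A sA | x gx A sA].
  by case: (sA) => -[_ AM _] _; apply: AM; [apply: gx | apply: gy].
by case: (sA) => -[_ _ AV] _; apply: AV; apply: gx.
Qed.

Lemma sub_gen_set X : X `<=` gen_set X.
Proof. exact: sub_gen_smallest. Qed.

Lemma gen_set_min X A : subgroup_set A -> X `<=` A -> gen_set X `<=` A.
Proof. exact: smallest_sub. Qed.

Lemma gen_set_normal X :
  (forall x y, X x -> X (x ^ y)) -> normal_set (gen_set X).
Proof.
move=> XJ; have [g1 gM gV] := gen_set_subgroup X; split=> // x y gx.
apply: (@gen_set_min X (fun x => gen_set X (x ^ y))) gx.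
  split=> [|u v ? ?|u ?]; rewrite ?conj1g ?conjMg ?conjVg //; [exact: gM | exact: gV].
by move=> u Xu; apply: sub_gen_set; apply: XJ.
Qed.

Lemma normal_setT : normal_set setT.
Proof. by []. Qed.

Lemma normal_setI A B : normal_set A -> normal_set B -> normal_set (A `&` B).
Proof.
move=> nA nB; split; [split |].
- by split; apply: nset1.
- by move=> x y [Ax Bx] [Ay By]; split; apply: nsetM.
- by move=> x [Ax Bx]; split; apply: nsetV.
- by move=> x y [Ax Bx]; split; apply: nsetJ.
Qed.

Lemma comm_set_mem A B x y : A x -> B y -> comm_set A B [~ x, y].
Proof. by move=> Ax By; apply: sub_gen_set; exists x => //; exists y. Qed.

Lemma comm_set_min A B C : subgroup_set C ->
  (forall x y, A x -> B y -> C [~ x, y]) -> comm_set A B `<=` C.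
Proof. by move=> sC h; apply: gen_set_min => // _ [x Ax [y By <-]]; apply: h. Qed.

Lemma comm_setS A B C D : A `<=` B -> C `<=` D -> comm_set A C `<=` comm_set B D.
Proof.
move=> sAB sCD; apply: comm_set_min; first exact: gen_set_subgroup.
by move=> x y /sAB ? /sCD ?; apply: comm_set_mem.
Qed.

Lemma comm_set_normal A B :
  normal_set A -> normal_set B -> normal_set (comm_set A B).
Proof.
move=> [_ nA] [_ nB]; apply: gen_set_normal => _ z [x Ax [y By <-]].
by exists (x ^ z); [exact: nA | exists (y ^ z); rewrite ?conjRg //; apply: nB].
Qed.

Lemma lcomm_set_normal A k : normal_set A -> normal_set (lcomm_set A k).
Proof. by move=> nA; elim: k => //= k IHk; apply: comm_set_normal. Qed.

Lemma lcomm_setS A B k : A `<=` B -> lcomm_set A k `<=` lcomm_set B k.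
Proof. by move=> sAB; elim: k => //= k IHk; apply: comm_setS. Qed.

Lemma lcomm_set_add A i j : lcomm_set (lcomm_set A i) j = lcomm_set A (j + i).
Proof. by rewrite /lcomm_set iterD. Qed.

Lemma lcomm_setSr A k :
  comm_set (lcomm_set A k) setT = lcomm_set (comm_set A setT) k.
Proof. by elim: k => [|k IHk] //; exact: (congr1 (fun B => comm_set B setT) IHk). Qed.

Lemma lcomm_set_sub A k : normal_set A -> lcomm_set A k.+1 `<=` lcomm_set A k.
Proof.
move=> nA; have nAk := lcomm_set_normal k nA.
by apply: comm_set_min (nset_subgroup nAk) _ => x y Ax _; apply: nset_commL.
Qed.

Lemma lcomm_set_subset A k : normal_set A -> lcomm_set A k `<=` A.
Proof. by move=> nA; elim: k => [|k IHk] x // /(lcomm_set_sub nA)/IHk. Qed.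

(** Reduces a commutator condition on a generated subgroup to its generators: [x x', y] = [x, y]^x'
    [x', y], and [C] is normal. *)
Lemma centralizes_subgroup Y C : normal_set C ->
  subgroup_set [set x | forall y, Y y -> C [~ x, y]].
Proof.
move=> nC; split=> [y _ | x x' cx cx' y Yy | x cx y Yy].
- by rewrite comm1g; apply: nset1.
- by rewrite commMg_conj; apply: nsetM => //; [apply: nsetJ (cx _ _) | apply: cx'].
- by rewrite commVg_conj; apply: (nsetJ nC); apply: (nsetV nC); apply: cx.
Qed.

(* Iterated three subgroups lemma: the Hall-Witt identity drives the induction on i. *)
Lemma comm_lcomm_set A C D :
  normal_set A -> normal_set C -> normal_set D ->
  (forall j x y, A x -> lcomm_set C j y -> lcomm_set D j [~ x, y]) ->
  forall i j x y,
    lcomm_set A i x -> lcomm_set C j y -> lcomm_set D (i + j) [~ x, y].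
Proof.
move=> nA nC nD ACD; elim=> [|i IHi] j x y; first exact: ACD.
move=> Ax; move: y; move: x Ax; apply: comm_set_min.
  exact/centralizes_subgroup/lcomm_set_normal.
move=> a f Aa _ y Cy; have nD' k := lcomm_set_normal k nD.
have nA' k := lcomm_set_normal k nA; have nC' k := lcomm_set_normal k nC.
have Cfy : lcomm_set C j.+1 [~ f^-1, y^-1].
  apply: (nset_commC (nC' _)); apply: comm_set_mem => //.
  exact: (nsetV (nC' _)).
have Day : lcomm_set D (i + j) [~ y, a^-1].
  by apply: (nset_commC (nD' _)); apply: IHi => //; apply: (nsetV (nA' _)).
(* The identity makes a conjugate of [a, f, y] the inverse of a product of two factors. The one from
   [f^-1, y^-1, a] is handled by the induction hypothesis at [j.+1]; the one from [y, a^-1, f^-1]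
   because [y, a^-1] lies in [D, _(i+j) F]. *)
have := Hall_Witt a f^-1 y; rewrite invgK => /eqP; rewrite -mulgA mulg_eq1 => /eqP e.
rewrite -[X in lcomm_set _ _ X](conjgK f^-1) e.
apply: (nsetJ (nD' _)); apply: (nsetV (nD' _)); apply: (nsetM (nD' _)).
  apply: (nsetJ (nD' _)); apply: (nset_commC (nD' _)).
  by rewrite addSnnS; apply: IHi.
by apply: (nsetJ (nD' _)); apply: comm_set_mem.
Qed.

(** [lcomm_set setT i] is the term gamma_(i+1) of the lower central series of [F], whence the
    successor in the index. The iterated three subgroups lemma is used with D = [A, F]. *)
Lemma lcomm_set_comm A i j x y : normal_set A ->
  lcomm_set setT i x -> lcomm_set A j y -> lcomm_set A (i + j).+1 [~ x, y].
Proof.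
move=> nA Tx Ay; rewrite -[X in lcomm_set A X]addn1 -lcomm_set_add.
have nA1 := lcomm_set_normal 1 nA.
apply: (comm_lcomm_set normal_setT nA nA1) Tx Ay => k u v _ Av.
rewrite lcomm_set_add addn1.
apply: (nset_commC (lcomm_set_normal k.+1 nA)); exact: comm_set_mem.
Qed.

End SubgroupSets.

(** * Finite sections *)

Section Sections.
Variable F : groupType.
Implicit Types A B C D X Y : set F.
Local Open Scope classical_set_scope.

(** The condition of [isog_section] with its epimorphism named, so that a single map can be
    restricted to subgroups and composed with quotient maps. *)
Definition section_map A B (mT : finGroupType) (M : {group mT}) (phi : F -> mT) :=
  [/\ forall x y, A x -> A y -> phi (x * y) = phi x * phi y,
      phi @` A = [set` M]
    & [set x | A x /\ phi x = 1] = B].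

Section SectionMap.
Variables (A B : set F) (mT : finGroupType) (M : {group mT}) (phi : F -> mT).
Hypotheses (sA : subgroup_set A) (sm : section_map A B M phi).

Lemma section_mapM x y : A x -> A y -> phi (x * y) = phi x * phi y.
Proof. by case: sm => phiM _ _; apply: phiM. Qed.

Lemma section_map_mem x : A x -> phi x \in M.
Proof.
move=> Ax; case: sm => _ im _; have: (phi @` A) (phi x) by exists x.
by rewrite im.
Qed.

Lemma section_map_onto m : m \in M -> exists2 x, A x & phi x = m.
Proof.
move=> Mm; case: sm => _ im _; suff: (phi @` A) m by case=> x; exists x.
by rewrite im.
Qed.

Lemma section_map_ker x : A x -> phi x = 1 -> B x.
Proof. by case: sm => _ _ <-. Qed.

Lemma section_map_sub x : B x -> A x.
Proof. by case: sm => _ _ <- []. Qed.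

Lemma section_map_triv x : B x -> phi x = 1.
Proof. by case: sm => _ _ <- []. Qed.

Lemma section_map1 : phi 1 = 1.
Proof.
have [A1 _ _] := sA; apply: (mulgI (phi 1)).
by rewrite -section_mapM // !mulg1.
Qed.

Lemma section_mapV x : A x -> phi x^-1 = (phi x)^-1.
Proof.
have [_ _ AV] := sA => Ax; apply: (mulgI (phi x)).
by rewrite -section_mapM ?mulgV ?section_map1 //; apply: AV.
Qed.

Lemma section_mapX x n : A x -> phi (x ^+ n) = phi x ^+ n.
Proof.
have [A1 AM _] := sA => Ax; have AX k : A (x ^+ k).
  by elim: k => // k IHk; rewrite expgS; apply: AM.
by elim: n => [|n IHn]; rewrite ?section_map1 // !expgS section_mapM // IHn.
Qed.

Lemma section_map_eq x y : A x -> A y -> phi x = phi y <-> B (x^-1 * y).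
Proof.
have [A1 AM AV] := sA => Ax Ay; have AVx := AV _ Ax; split=> [e | /section_map_triv].
  apply: section_map_ker; first exact: AM.
  by rewrite section_mapM // section_mapV // e mulVg.
by rewrite section_mapM // section_mapV // => /eqP; rewrite mulg_eq1 eqg_inv => /eqP.
Qed.

Lemma section_map_abelian :
  (forall x y, A x -> A y -> B [~ x, y]) -> abelian M.
Proof.
move=> cA; have [_ AM _] := sA.
apply/centsP => _ /section_map_onto[x Ax <-] _ /section_map_onto[y Ay <-].
have Bxy := cA x y Ax Ay; have Axy := section_map_sub Bxy.
rewrite /commute -(section_mapM Ax Ay) commgC section_mapM //; last exact: AM.
by rewrite (section_map_triv Bxy) mulg1 section_mapM.
Qed.

Lemma section_map_restrict A' : subgroup_set A' -> A' `<=` A ->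
  exists2 M' : {group mT}, M' \subset M & section_map A' (A' `&` B) M' phi.
Proof.
move=> [A'1 A'M A'V] sA'A.
pose E := [set m in M | `[<exists2 x, A' x & phi x = m>]]%SET.
have gE : group_set E.
  apply/group_setP; split.
    rewrite inE group1; apply/asboolP; exists 1 => //; exact: section_map1.
  move=> u v; rewrite !inE => /andP[Mu /asboolP[x Ax <-]] /andP[Mv /asboolP[y Ay <-]].
  rewrite !groupM ?section_map_mem //; try exact: sA'A.
  apply/asboolP; exists (x * y); first exact: A'M.
  by rewrite section_mapM //; apply: sA'A.
exists (Group gE); first by apply/fintype.subsetP => m; rewrite inE => /andP[].
split.
- by move=> x y /sA'A ? /sA'A ?; apply: section_mapM.
- apply/seteqP; split=> [_ [x Ax <-] | m] /=.
    rewrite inE section_map_mem /=; last exact: sA'A.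
    by apply/asboolP; exists x.
  by rewrite inE => /andP[_ /asboolP].
- apply/seteqP; split=> [x [A'x p1] | x [A'x Bx]]; split=> //.
    by apply: section_map_ker => //; apply: sA'A.
  exact: section_map_triv.
Qed.

(** The universal property of the quotient A / B, transported to its model [M] by choosing a
    preimage [g m] of each [m] in [M]. *)
Lemma section_map_factor (kT : finGroupType) (psi : F -> kT) :
  (forall x y, A x -> A y -> psi (x * y) = psi x * psi y) ->
  (forall x, B x -> psi x = 1) ->
  exists f : {morphism M >-> kT}, forall x, A x -> f (phi x) = psi x.
Proof.
move=> psiM psiB; have [A1 AM AV] := sA.
have psi1 : psi 1 = 1 by apply: (mulgI (psi 1)); rewrite -psiM // !mulg1.
have psiV x : A x -> psi x^-1 = (psi x)^-1.
  by move=> Ax; apply: (mulgI (psi x)); rewrite -psiM ?mulgV ?psi1 //; apply: AV.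
have /choice[g gP] m : exists x, m \in M -> A x /\ phi x = m.
  have [/section_map_onto[x Ax e]|//] := boolP (m \in M); first by exists x.
  by exists 1.
have psi_phi x y : A x -> A y -> phi x = phi y -> psi x = psi y.
  move=> Ax Ay /(section_map_eq Ax Ay)/psiB; rewrite psiM ?psiV //; last exact: AV.
  by move/eqP; rewrite mulg_eq1 eqg_inv => /eqP.
have gM : {in M &, {morph psi \o g : u v / u * v}}.
  move=> u v Mu Mv /=; have [Au eu] := gP _ Mu; have [Av ev] := gP _ Mv.
  have [Auv euv] := gP _ (groupM Mu Mv).
  by rewrite -psiM //; apply: psi_phi; rewrite ?section_mapM ?eu ?ev //; apply: AM.
exists (Morphism gM) => x Ax /=.
by have [Ag eg] := gP _ (section_map_mem Ax); apply: psi_phi.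
Qed.

(** Third isomorphism theorem: A / C is the quotient of A / B by C / B, and [X] models C / B inside
    [M]. *)
Lemma section_map_quotient C : subgroup_set C -> C `<=` A -> B `<=` C ->
  (forall x y, C x -> A y -> C (x ^ y)) ->
  forall X : {group mT}, section_map C B X phi ->
  section_map A C (M / X)%G (coset X \o phi) /\ X <| M.
Proof.
move=> [C1 CM CV] sCA sBC nC X smX.
have sXM : X \subset M.
  apply/fintype.subsetP => m; case: smX => _ im _.
  have /= : [set` X] m -> m \in M.
    by rewrite -im => -[x /sCA Ax <-]; apply: section_map_mem.
  exact.
have XP x : C x -> phi x \in X.
  by move=> Cx; case: smX => _ im _; have: [set` X] (phi x) by rewrite -im; exists x.
have onX m : m \in X -> exists2 x, C x & phi x = m.
  by move=> Xm; case: smX => _ im _; have: [set` X] m by []; rewrite -im.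
have [A1 AM AV] := sA.
have nXM : X <| M.
  rewrite /normal sXM; apply/fintype.subsetP => _ /section_map_onto[y Ay <-].
  rewrite inE; apply/fintype.subsetP => _ /imsetP[_ /onX[x Cx <-] ->].
  rewrite conjgE -section_mapV //; have Ax := sCA _ Cx; have AVy := AV _ Ay.
  by rewrite -!section_mapM //; [apply/XP/nC | apply: AM].
have nX x : A x -> phi x \in 'N(X).
  by move=> Ax; apply: (fintype.subsetP (normal_norm nXM)); apply: section_map_mem.
split=> //; split.
- by move=> x y Ax Ay /=; rewrite section_mapM // morphM //; apply: nX.
- apply/seteqP; split=> [_ [x Ax <-] | m] /=; first exact/mem_quotient/section_map_mem.
  by case/morphimP=> _ _ /section_map_onto[x Ax <-] ->; exists x.
- apply/seteqP; split=> [x [Ax /= e] | x Cx]; last first.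
    by split=> [|/=]; [apply: sCA | apply/coset_id/XP].
  have /onX[y Cy e'] : phi x \in X.
    by rewrite -(ker_coset X); apply/kerP => //; apply: nX.
  have Ay := sCA _ Cy; have Bxy : B (y^-1 * x) by apply/section_map_eq.
  by rewrite -(mulVKg y x); apply: CM => //; apply: sBC.
Qed.

End SectionMap.

(** [psi] factors through [phi], and the factor is bijective because both maps have kernel [B]. *)
Lemma section_map_card A B (mT kT : finGroupType) (M : {group mT})
    (K : {group kT}) (phi : F -> mT) (psi : F -> kT) :
  subgroup_set A -> section_map A B M phi -> section_map A B K psi ->
  #|M| = #|K|.
Proof.
move=> sA smM smK.
have [f fP] := section_map_factor sA smM (section_mapM smK) (section_map_triv smK).
have injf : 'injm f.
  apply/injmP => _ _ /(section_map_onto smM)[x Ax <-] /(section_map_onto smM)[y Ay <-].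
  by rewrite !fP // => /(section_map_eq sA smK Ax Ay) ?; apply/(section_map_eq sA smM).
rewrite -(card_injm injf (subxx M)); apply: eq_card => k; apply/morphimP/idP.
  case=> _ _ /(section_map_onto smM)[x Ax <-] ->; rewrite fP //.
  exact: section_map_mem smK _ Ax.
case/(section_map_onto smK) => x Ax <-; exists (phi x); rewrite ?fP //;
  exact: section_map_mem smM _ Ax.
Qed.

End Sections.

(** * Finite index and finite models of sections *)

Section FiniteIndex.
Variable F : groupType.
Implicit Types A B C D X Y : set F.
Local Open Scope classical_set_scope.

Definition finite_index A B :=
  exists s : seq F, forall x, A x -> exists2 y, y \in s & B (y^-1 * x).

Lemma finite_index_trans A B C :
  finite_index A B -> finite_index B C -> finite_index A C.
Proof.
move=> [s sP] [r rP]; exists [seq y * z | y <- s, z <- r] => x /sP[y sy /rP[z rz Cz]].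
by exists (y * z); [apply: allpairs_f | rewrite invgM -mulgA].
Qed.

Lemma section_finite_index A B (mT : finGroupType) (M : {group mT}) phi :
  subgroup_set A -> section_map A B M phi -> finite_index A B.
Proof.
move=> sA sm; have /choice[g gP] m : exists x, m \in M -> A x /\ phi x = m.
  have [/(section_map_onto sm)[x Ax e]|//] := boolP (m \in M); first by exists x.
  by exists 1.
exists [seq g m | m <- enum M] => x Ax; have Mx := section_map_mem sm Ax.
have [Ag eg] := gP _ Mx; exists (g (phi x)); first by rewrite map_f // mem_enum.
exact/(section_map_eq sA sm).
Qed.

(* A acts on A / B by right multiplication, and the kernel of this action is B. *)
Lemma finite_index_section A B : subgroup_set A -> normal_set B -> B `<=` A ->
  finite_index A B ->
  exists (mT : finGroupType) (M : {group mT}), isog_section A B M.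
Proof.
move=> [A1 AM AV] nB sBA [s sP]; pose n := (size s).+1.
(* [r x] is the position of the first representative of the coset of [x]. When none is found [find]
   returns [size s], hence the successor in [n]. *)
pose r x : 'I_n := inord (find (fun y => `[<B (y^-1 * x)>]) s).
have rP x y : A x -> A y -> r x = r y <-> B (x^-1 * y).
  move=> Ax Ay; split=> [|Bxy]; last first.
    congr (inord _); apply: eq_find => z; apply: asbool_equiv_eq; split=> Bz.
      by rewrite -(mulVKg x y) mulgA; apply: (nsetM nB).
    rewrite -(mulVKg y x) mulgA; apply: (nsetM nB) => //.
    by apply: (nsetVE nB); rewrite invgM invgK.
  have hasr z : A z -> has (fun y => `[<B (y^-1 * z)>]) s.
    by case/sP=> w sw Bw; apply/hasP; exists w => //; apply/asboolP.
  have fr z : A z -> r z = find (fun y => `[<B (y^-1 * z)>]) s :> nat.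
    by move=> Az; rewrite inordK // ltnS find_size.
  move/(congr1 val); rewrite /= !fr // => e.
  have /asboolP Bx := nth_find 1 (hasr x Ax).
  have /asboolP By := nth_find 1 (hasr y Ay).
  rewrite -e in By; move: Bx By; set z := nth _ _ _ => Bx By.
  by have := nsetM nB (nsetV nB Bx) By; rewrite invgM invgK -mulgA mulVKg.
(* The positions reached from [A] form a finite type of cosets of [B] in [A], with chosen
   representatives [xx]. *)
pose T := {i : 'I_n | `[<exists2 x, A x & r x = i>]}.
have /choice[xx xxP] (i : T) : exists x, A x /\ r x = val i.
  by have /asboolP[x] := valP i; exists x.
have Tr x : A x -> `[<exists2 y, A y & r y = r x>].
  by move=> Ax; apply/asboolP; exists x.
pose cl x : T := insubd (Sub (r 1) (Tr 1 A1)) (r x).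
have clE x : A x -> val (cl x) = r x by move=> Ax; rewrite val_insubd Tr.
have clP x y : A x -> A y -> cl x = cl y <-> B (x^-1 * y).
  move=> Ax Ay; rewrite -rP // -!clE //; split=> [->//|]; exact: val_inj.
have Axx i : A (xx i) by case: (xxP i).
have clxx i : cl (xx i) = i by apply: val_inj; rewrite clE //; case: (xxP i).
have clM x y a : A x -> A y -> A a -> cl x = cl y <-> cl (x * a) = cl (y * a).
  move=> Ax Ay Aa; have Axa := AM _ _ Ax Aa; have Aya := AM _ _ Ay Aa; rewrite !clP //.
  have -> : (x * a)^-1 * (y * a) = (x^-1 * y) ^ a by rewrite conjgE invgM !mulgA.
  split=> [|Ba]; first exact: nsetJ.
  by rewrite -(conjgK a (_ * _)); apply: nsetJ.
(* The default [1] is never taken for [a] in [A], since right multiplication by [a] is then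
   injective on cosets. *)
pose phi a : {perm T} := odflt 1 [pick p : {perm T} | [forall i, p i == cl (xx i * a)]].
have phiE : forall b i, A b -> phi b i = cl (xx i * b).
  move=> b i Ab; rewrite /phi; case: pickP => [p /forallP/(_ i)/eqP // | no].
  have inj : injective (fun i => cl (xx i * b)).
    by move=> i1 i2 e; rewrite -(clxx i1) -(clxx i2); apply/(clM _ _ b).
  by have /forallP[] := no (perm inj) => i1; rewrite permE.
have phiM x y : A x -> A y -> phi (x * y) = phi x * phi y.
  move=> Ax Ay; apply/permP => i; rewrite permM !phiE //; last exact: AM.
  rewrite mulgA; apply: (clM _ _ y _ _ Ay).1; rewrite ?clxx //; exact: AM.
have phi1 : phi 1 = 1 by apply: (mulgI (phi 1)); rewrite -phiM // !mulg1.
have gM : group_set [set p : {perm T} | `[<exists2 a, A a & phi a = p>]]%SET.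
  apply/group_setP; split; first by rewrite !inE; exists 1.
  move=> p q; rewrite !inE => -[x Ax <-] [y Ay <-].
  by exists (x * y); [apply: AM | rewrite phiM].
exists {perm T}, (Group gM), phi; split=> //.
- apply/seteqP; split=> [_ [x Ax <-] | p] /=; rewrite !inE //.
  by exists x.
- have xB i x : A x -> B ((xx i * x)^-1 * xx i) <-> B x.
    move=> Ax; rewrite invgM -mulgA mulVg mulg1; split=> [/(nsetVE nB) //|].
    exact: nsetV.
  apply/seteqP; split=> [x [Ax /permP/(_ (cl 1))] | x Bx].
    rewrite phiE // perm1 -{2}(clxx (cl 1)) => /clP e.
    by apply/xB/e => //; apply: AM.
  have Ax := sBA _ Bx; split=> //; apply/permP => i; rewrite phiE // perm1 -[RHS]clxx.
  by apply/clP => //; [apply: AM | apply/xB].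
Qed.

End FiniteIndex.

(** * The commutator pairing *)

Section CommutatorPairing.
Variable F : groupType.
Implicit Types A B C D L R V X Y : set F.
Local Open Scope classical_set_scope.

Definition eqmod D (x y : F) := D (x^-1 * y).

Section Eqmod.
Variables (D : set F) (nD : normal_set D).

Lemma eqmod_refl x : eqmod D x x.
Proof. by rewrite /eqmod mulVg; apply: nset1. Qed.

Lemma eqmod_sym x y : eqmod D x y -> eqmod D y x.
Proof. by move/(nsetV nD); rewrite /eqmod invgM invgK. Qed.

Lemma eqmod_trans y x z : eqmod D x y -> eqmod D y z -> eqmod D x z.
Proof. by move=> Dxy Dyz; rewrite /eqmod -(mulVKg y z) mulgA; apply: (nsetM nD). Qed.

Lemma eqmodM x x' y y' : eqmod D x x' -> eqmod D y y' -> eqmod D (x * y) (x' * y').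
Proof.
move=> Dx Dy; rewrite /eqmod.
have -> : (x * y)^-1 * (x' * y') = (x^-1 * x') ^ y * (y^-1 * y').
  by rewrite conjgE invgM !mulgA mulgK.
by apply: (nsetM nD) => //; apply: nsetJ.
Qed.

Lemma eqmodV x y : eqmod D x y -> eqmod D x^-1 y^-1.
Proof.
move=> Dxy; rewrite /eqmod.
have -> : x^-1^-1 * y^-1 = (x^-1 * y)^-1 ^ x^-1.
  by rewrite conjgE !invgM !invgK !mulgA mulgK.
by apply: (nsetJ nD); apply: (nsetV nD).
Qed.

Lemma eqmod1 x : eqmod D 1 x <-> D x.
Proof. by rewrite /eqmod invg1 mul1g. Qed.

Lemma eqmod_mem V x y : subgroup_set V -> D `<=` V -> eqmod D x y -> V x -> V y.
Proof. by move=> [_ VM _] sDV /sDV Dxy Vx; rewrite -(mulVKg x y); apply: VM. Qed.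

End Eqmod.

Section Pairing.
Variables (A B : set F).
Hypotheses (nA : normal_set A) (nB : normal_set B).
Hypothesis sAB : comm_set A setT `<=` B.
Local Notation B' := (comm_set B setT).

Let nB' : normal_set B'. Proof. exact: comm_set_normal (normal_setT F). Qed.

Let commB' a f g : A a -> B' [~ [~ a, f], g].
Proof. by move=> Aa; apply: comm_set_mem => //; apply: sAB; apply: comm_set_mem. Qed.

(** The error is [[a, f], a'], an element of [A, F, F] <= [B, F]. With [commgM_eqmod] this is the
    biadditivity of the commutator modulo [B, F]. *)
Lemma commMg_eqmod a a' f : A a ->
  eqmod B' ([~ a, f] * [~ a', f]) [~ a * a', f].
Proof.
move=> Aa; rewrite commMg_conj.
by apply: (eqmodM nB'); [exact: commB' | apply: eqmod_refl].
Qed.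

Lemma commgM_eqmod a f f' : A a ->
  eqmod B' ([~ a, f] * [~ a, f']) [~ a, f * f'].
Proof.
move=> Aa; rewrite commgM_conj; apply: (@eqmod_trans _ nB' ([~ a, f'] * [~ a, f])).
  by rewrite /eqmod invgM -mulgA; have := commB' f' [~ a, f] Aa; rewrite commgEl conjgE.
by apply: (eqmodM nB'); [apply: eqmod_refl | exact: commB'].
Qed.

Lemma commXg_eqmod a f n : A a -> eqmod B' ([~ a, f] ^+ n) [~ a ^+ n, f].
Proof.
move=> Aa; elim: n => [|n IHn]; first by rewrite !expg0 comm1g; apply: eqmod_refl.
rewrite !expgS; apply: (eqmod_trans nB') (commMg_eqmod _ f Aa).
by apply: (eqmodM nB') => //; apply: eqmod_refl.
Qed.

Lemma comm_eqmodL a a' f : A a -> eqmod B a a' -> eqmod B' [~ a, f] [~ a', f].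
Proof.
move=> Aa Baa; rewrite -(mulVKg a a').
apply: (eqmod_trans nB') (commMg_eqmod _ f Aa).
rewrite -{1}[ [~ a, f] ]mulg1; apply: (eqmodM nB'); first exact: eqmod_refl.
by apply/eqmod1; apply: comm_set_mem.
Qed.

Lemma comm_eqmodR a f f' : A a -> B' [~ a, f^-1 * f'] -> eqmod B' [~ a, f] [~ a, f'].
Proof.
move=> Aa Bff; rewrite -(mulVKg f f').
apply: (eqmod_trans nB') (commgM_eqmod f _ Aa).
rewrite -{1}[ [~ a, f] ]mulg1; apply: (eqmodM nB'); first exact: eqmod_refl.
exact/eqmod1.
Qed.

End Pairing.

(** * Finiteness of commutator sections *)

Lemma finite_indexS A A' B B' : A' `<=` A -> B `<=` B' ->
  finite_index A B -> finite_index A' B'.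
Proof. by move=> sA sB [s sP]; exists s => x /sA/sP[y sy /sB]; exists y. Qed.

Lemma finite_index_exponent A B : subgroup_set A -> normal_set B -> B `<=` A ->
  finite_index A B -> exists n, forall a, A a -> B (a ^+ n.+1).
Proof.
move=> sA nB sBA /(finite_index_section sA nB sBA)[mT [M [phi sm]]].
exists #|M|.-1 => a Aa; rewrite prednK ?cardG_gt0 //.
have AX k : A (a ^+ k).
  by case: sA => A1 AM _; elim: k => // k IHk; rewrite expgS; apply: AM.
apply: (section_map_ker sm); rewrite // (section_mapX sA sm) //.
exact/expg_cardG/(section_map_mem sm).
Qed.

(** Finitely many elements that are central and of finite order modulo [B] generate a finite group
    modulo [B]. They are adjoined one at a time, each multiplying the index by at most n + 1. *)
Lemma finite_index_central B n (s : seq F) : normal_set B ->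
  (forall x, x \in s -> B (x ^+ n.+1) /\ forall y, B [~ x, y]) ->
  exists V, [/\ normal_set V, B `<=` V, forall x, x \in s -> V x,
    finite_index V B & forall v y, V v -> B [~ v, y]].
Proof.
move=> nB; elim: s => [|x s IHs] sP.
  exists B; split=> //; last by move=> v y; apply: nset_commL.
  by exists [:: 1] => x Bx; exists 1; rewrite ?inE // invg1 mul1g.
have [|V [nV sBV sV fV cV]] := IHs.
  by move=> y sy; apply: sP; rewrite inE sy orbT.
have [Bxn cx] := sP x (mem_head _ _).
have cX i y : B [~ x ^+ i, y].
  have sC := centralizes_subgroup setT nB; have [C1 CM _] := sC.
  suff : [set z | forall y, [set: F] y -> B [~ z, y]] (x ^+ i) by apply.
  elim: i => [|i IHi]; first exact: C1.
  by rewrite expgS; apply: CM.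
(* [W] is the product of [V] and the powers of [x]; nonnegative powers suffice, because [x] has
   finite order modulo [B]. *)
pose W : set F := [set z | exists i, V (x ^- i * z)].
have WE z : W z -> exists i, exists2 v, V v & z = x ^+ i * v.
  by case=> i Vz; exists i, (x ^- i * z); rewrite // mulVKg.
have WI i v : V v -> W (x ^+ i * v) by move=> Vv; exists i; rewrite mulKg.
have sVW : V `<=` W by move=> v /(WI 0); rewrite expg0 mul1g.
have cW v y : W v -> B [~ v, y].
  move=> /WE[i [{}v Vv ->]]; rewrite commMg_conj; apply: (nsetM nB).
    by apply: (nsetJ nB); apply: cX.
  exact: cV.
have sW : subgroup_set W.
  split.
  - by apply: sVW; apply: (nset1 nV).
  - move=> _ _ /WE[i [u Vu ->]] /WE[j [v Vv ->]].
    have -> : x ^+ i * u * (x ^+ j * v) = x ^+ (i + j) * (u ^ (x ^+ j) * v).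
      by rewrite expgnDr conjgE !mulgA mulgK.
    by apply: WI; apply: (nsetM nV) => //; apply: (nsetJ nV).
  (* Modulo [B] the inverse of x^i is x^(i n), as x^(i (n + 1)) lies in [B]. *)
  - move=> _ /WE[i [v Vv ->]]; exists (i * n)%N.
    have -> : x ^- (i * n) * (x ^+ i * v)^-1 = v^-1 ^ x ^+ (i * n) * (x ^- (n.+1 * i)).
      by rewrite conjgE invgM mulSn expgnDr invgM [(n * i)%N]mulnC !mulgA mulgK.
    apply: (nsetM nV); first by apply: (nsetJ nV); apply: (nsetV nV).
    apply: (nsetV nV); apply: sBV; rewrite expgnA.
    by elim: i => [|i IHi]; [exact: nset1 | rewrite expgS; apply: (nsetM nB)].
exists W; split=> //.
- split=> // v y Wv; case: sW => _ WM _; rewrite -(mulVKg v (v ^ y)).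
  by apply: WM => //; apply: sVW; apply: sBV; apply: cW.
- by move=> v /sBV; apply: sVW.
- move=> y; rewrite inE => /predU1P[-> | /sV]; last exact: sVW.
  by have:= WI 1%N 1 (nset1 nV); rewrite mulg1 expg1.
- apply: finite_index_trans fV.
  exists [seq x ^+ i | i <- iota 0 n.+1] => _ /WE[i [v Vv ->]].
  exists (x ^+ (i %% n.+1)); first by rewrite map_f // mem_iota ltn_mod.
  rewrite {2}(divn_eq i n.+1) addnC expgnDr -!mulgA mulKg; apply: (nsetM nV) => //.
  apply: sBV; rewrite mulnC expgnA.
  by elim: (i %/ _) => [|j IHj]; [exact: nset1 | rewrite expgS; apply: (nsetM nB)].
Qed.

(* Modulo [B, F], the group [A, F] is central, and generated by the finitely many
   elements [a, f] with a running over A / B and f over F / R. *)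
Lemma finite_index_comm A B R :
  normal_set A -> normal_set B -> B `<=` A -> comm_set A setT `<=` B ->
  (forall a w, A a -> R w -> comm_set B setT [~ a, w]) ->
  finite_index A B -> finite_index setT R ->
  finite_index (comm_set A setT) (comm_set B setT).
Proof.
move=> nA nB sBA sAB cAR fAB fR; have nT := normal_setT F.
have nB' : normal_set (comm_set B setT) by apply: comm_set_normal.
have [n nP] := finite_index_exponent (nset_subgroup nA) nB sBA fAB.
have [sa saP] := fAB; have [sf sfP] := fR.
pose s := [seq [~ a, f] | a <- [seq a <- sa | `[<A a>]], f <- sf].
have [|V [nV sBV sV fV _]] := @finite_index_central (comm_set B setT) n s nB'.
  move=> _ /allpairsP[[a f] /= [+ _ ->]]; rewrite mem_filter => /andP[/asboolP Aa _].
  split=> [|y]; last by apply: comm_set_mem => //; apply: sAB; apply: comm_set_mem.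
  have := commXg_eqmod nB sAB f n.+1 Aa.
  move/(eqmod_sym nB')/(eqmod_mem (nset_subgroup nB')); apply=> //.
  by apply: comm_set_mem => //; apply: nP.
apply: finite_indexS fV => //; apply: comm_set_min; first exact: nset_subgroup.
move=> a f Aa _; have [a0 sa0 Ba] := saP a Aa; have [f0 sf0 Rf] := sfP f I.
have Aa0 : A a0.
  rewrite -[a0](mulVKg a); apply: (nsetM nA) => //; apply: sBA.
  by apply: (nsetVE nB); rewrite invgM invgK.
have Vaf : V [~ a0, f0].
  by apply: sV; apply: allpairs_f => //; rewrite mem_filter sa0 andbT; apply/asboolP.
apply: (eqmod_mem (nset_subgroup nV) sBV) Vaf.
apply: (eqmod_trans nB') (comm_eqmodR nB sAB Aa (cAR _ _ Aa Rf)).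
exact: (comm_eqmodL nB sAB f0 Aa0 Ba).
Qed.

(** Induction on [k] through [finite_index_comm]. Its second argument may be taken in the finite
    quotient F / R, since the three subgroups lemma puts [[L, _k F], R] inside [L', _(k+1) F]. *)
Lemma finite_index_lcomm L L' R k :
  normal_set L -> normal_set L' -> normal_set R ->
  L' `<=` L -> R `<=` L' -> comm_set L setT `<=` L' -> finite_index setT R ->
  finite_index (lcomm_set L k) (lcomm_set L' k).
Proof.
move=> nL nL' nR sL'L sRL' sLL' fR; elim: k => [|k IHk].
  exact: finite_indexS fR.
apply: (@finite_index_comm _ _ R); rewrite ?fR //; try exact: lcomm_set_normal.
- exact: lcomm_setS.
- by rewrite lcomm_setSr; apply: lcomm_setS.
move=> a w La Rw; rewrite lcomm_setSr -[X in lcomm_set _ X]addn0.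
apply: (@comm_lcomm_set _ L R (lcomm_set L' 1) nL nR _ _ k 0%N) => //.
  exact: lcomm_set_normal.
move=> j x y _ Ry; rewrite lcomm_set_add addn1; apply: (lcomm_setS sRL').
by apply: (nset_commC (lcomm_set_normal j.+1 nR)); apply: comm_set_mem.
Qed.

End CommutatorPairing.

(** * Free presentations *)

Section MultiplicativeMaps.
Variables (F H : groupType) (f : {multiplicative F -> H}).

Lemma multiplicative1 : f 1 = 1.
Proof. by apply: (mulgI (f 1)); rewrite -gmulfM !mulg1. Qed.

Lemma multiplicativeV x : f x^-1 = (f x)^-1.
Proof. by apply: (mulgI (f x)); rewrite -gmulfM !mulgV multiplicative1. Qed.

Lemma multiplicativeJ x y : f (x ^ y) = f x ^ f y.
Proof. by rewrite !conjgE !gmulfM multiplicativeV. Qed.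

Lemma multiplicativeR x y : f [~ x, y] = [~ f x, f y].
Proof. by rewrite !commgEl gmulfM multiplicativeV multiplicativeJ. Qed.

End MultiplicativeMaps.

(** * Homomorphisms between free presentations *)

Section Lifts.
Local Open Scope classical_set_scope.

Lemma lcomm_set_map (F F' : groupType) (alpha : {multiplicative F -> F'})
    (A : set F) (A' : set F') k :
  (forall x, A x -> A' (alpha x)) ->
  forall x, lcomm_set A k x -> lcomm_set A' k (alpha x).
Proof.
move=> AA'; elim: k => [|k IHk] //=.
have [g1 gM gV] := gen_set_subgroup [set [~ x, y] | x in lcomm_set A' k & y in setT].
apply: (@comm_set_min _ _ _ (fun x => comm_set (lcomm_set A' k) setT (alpha x))).
  split=> [|x y hx hy|x hx] /=; first by rewrite multiplicative1; apply: g1.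
    by rewrite gmulfM; apply: gM; [apply: hx | apply: hy].
  by rewrite multiplicativeV; apply: gV; apply: hx.
by move=> x y /IHk Ax _; rewrite multiplicativeR; apply: comm_set_mem.
Qed.

(** Free groups are projective: each basis element is sent to a preimage, and uniqueness in the
    universal property extends the equality from the basis to [F]. *)
Lemma free_group_lift (F F' H : groupType) (pi : {multiplicative F -> H})
    (pi' : {multiplicative F' -> H}) :
  free_group F -> range pi `<=` range pi' ->
  exists alpha : {multiplicative F -> F'}, forall x, pi' (alpha x) = pi x.
Proof.
move=> [X [i freeF]] spi.
have /choice[y yP] x : exists y, pi' y = pi (i x).
  by have [|y _ <-] := spi (pi (i x)); [exists (i x) | exists y].
have [[alpha alphaP] _] := freeF F' y; exists alpha => x.
have [_ uniq] := freeF H (pi \o i).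
by apply: (uniq (pi' \o alpha) pi) => // {}x /=; rewrite alphaP.
Qed.

(** For a generator [x, f], put a = alpha x and b = alpha f, and write beta x = a z, beta f = b r
    with z in [R, _k F] and r in R. Then [a, r] lies in [R, _(k+1) F] because a is in
    gamma_(k+1)(F'), and so does every [z, g]. *)
Lemma lcomm_set_eqmod (F F' : groupType) (alpha beta : {multiplicative F -> F'})
    (S : set F) (R : set F') : normal_set R ->
  (forall x, eqmod R (alpha x) (beta x)) ->
  forall k x, lcomm_set S k x -> eqmod (lcomm_set R k) (alpha x) (beta x).
Proof.
move=> nR abR; elim=> [|k IHk] x; first by move=> _; apply: abR.
have nRk := lcomm_set_normal k nR; have nD := lcomm_set_normal k.+1 nR.
pose E x := eqmod (lcomm_set R k.+1) (alpha x) (beta x).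
apply: (@comm_set_min _ _ _ E) => [|{}x f Sx _]; rewrite /E.
  split=> [|u v eu ev|u eu] /=.
  - by rewrite !multiplicative1; apply: (eqmod_refl nD).
  - by rewrite !gmulfM; apply: (eqmodM nD).
  - by rewrite !multiplicativeV; apply: (eqmodV nD).
rewrite !multiplicativeR; set a := alpha x; set b := alpha f.
have Ta : lcomm_set setT k a by apply: lcomm_set_map Sx.
have Rz := IHk x Sx; have Rr := abR f.
rewrite -(mulVKg a (beta x)) -(mulVKg b (beta f)).
move: Rz Rr; rewrite /eqmod -/a -/b; set z := _ * beta x; set r := _ * beta f => Rz Rr.
have Dr g : lcomm_set setT k g -> lcomm_set R k.+1 [~ g, r].
  by move=> Tg; rewrite -[k]addn0; exact: (@lcomm_set_comm _ R k 0%N _ _ nR Tg Rr).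
have Dz g : lcomm_set R k.+1 [~ z, g] by apply: comm_set_mem.
rewrite -/(eqmod _ _ _); apply: (@eqmod_trans _ _ nD [~ a, b * r]).
  rewrite commgM_conj -{1}[ [~ a, b] ]mul1g; apply: (eqmodM nD).
    by apply/eqmod1; apply: Dr.
  by apply: Dr; apply: nset_commL => //; apply: lcomm_set_normal.
rewrite commMg_conj -{1}[ [~ a, _] ]mulg1; apply: (eqmodM nD).
  by apply: (nset_commC nD); apply: Dz.
by apply/eqmod1; apply: Dz.
Qed.

End Lifts.

Section Presentations.
Local Open Scope classical_set_scope.
Variables (gT : finGroupType) (G : {group gT}).
Implicit Types (P Q : free_presentation G) (N : {group gT}).

Lemma fp_map_mem P x : fp_map P x \in G.
Proof. by have: range (fp_map P) (fp_map P x) by []; rewrite fp_onto. Qed.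

Lemma fp_map_onto P g : g \in G -> exists x, fp_map P x = g.
Proof.
move=> Gg; have: [set` G] g by [].
by rewrite -(fp_onto P) => -[x _ <-]; exists x.
Qed.

Lemma fp_ker_normal P : normal_set (@fp_ker _ _ P).
Proof.
rewrite /fp_ker; split; [split=> [|x y /= px py|x /= px] | move=> x y /= px].
- exact: multiplicative1.
- by rewrite gmulfM px py mulg1.
- by rewrite multiplicativeV px invg1.
- by rewrite multiplicativeJ px conj1g.
Qed.

Lemma fp_preim_normal P N : N <| G -> normal_set (@fp_preim _ _ P N).
Proof.
move=> nNG; rewrite /fp_preim; split;
  [split=> [|x y /= px py|x /= px] | move=> x y /= px].
- by rewrite /= multiplicative1 group1.
- by rewrite gmulfM groupM.
- by rewrite multiplicativeV groupV.
- rewrite multiplicativeJ memJ_norm //.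
  by rewrite (fintype.subsetP (normal_norm nNG)) ?fp_map_mem.
Qed.

Lemma fp_section P : section_map setT (@fp_ker _ _ P) G (fp_map P).
Proof.
split=> [x y _ _| |]; [exact: gmulfM | exact: fp_onto |].
by apply/seteqP; split=> [x []|x].
Qed.

Lemma is_multiplier_indep P Q c N (mT : finGroupType) (M : {group mT}) :
  is_multiplier P c N M -> is_multiplier Q c N M.
Proof.
have lift P1 P2 : exists alpha : {multiplicative fp_group P1 -> fp_group P2},
    forall x, fp_map P2 (alpha x) = fp_map P1 x.
  by apply: free_group_lift (fp_free P1) _; rewrite !fp_onto.
have [[alpha aP] [beta bP]] := (lift P Q, lift Q P).
pose A P1 := @fp_ker _ _ P1 `&` lcomm_set (@fp_preim _ _ P1 N) c.
pose B P1 := lcomm_set (@fp_ker _ _ P1) c.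
have lcommN P1 P2 (h : {multiplicative fp_group P1 -> fp_group P2}) :
    (forall x, fp_map P2 (h x) = fp_map P1 x) -> forall x, A P1 x -> A P2 (h x).
  move=> hP x [Rx Sx]; split; first by rewrite /fp_ker /= hP.
  by apply: lcomm_set_map Sx => y; rewrite /fp_preim /= hP.
have lcommR P1 P2 (h : {multiplicative fp_group P1 -> fp_group P2}) :
    (forall x, fp_map P2 (h x) = fp_map P1 x) -> forall x, B P1 x -> B P2 (h x).
  by move=> hP; apply: lcomm_set_map => y; rewrite /fp_ker /= hP.
(* The identity is another lift of the identity of [G], so [h] is compared with it. *)
have agree P1 (h : {multiplicative fp_group P1 -> fp_group P1}) :
    (forall x, fp_map P1 (h x) = fp_map P1 x) ->
    forall x, A P1 x -> eqmod (B P1) (h x) x.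
  move=> hP x [_]; apply: (@lcomm_set_eqmod _ _ h idfun); first exact: fp_ker_normal.
  by move=> y; rewrite /eqmod /fp_ker /= gmulfM multiplicativeV hP mulVg.
have nB P1 : normal_set (B P1) by apply/lcomm_set_normal/fp_ker_normal.
(* Surjectivity will come from beta (alpha x) = x modulo [B P], and the kernel from alpha (beta x) =
   x modulo [B Q]. *)
move=> [phi sm]; exists (phi \o beta).
have phiE x y : A P x -> A P y -> eqmod (B P) x y -> phi x = phi y.
  move=> Ax Ay e; rewrite -(mulVKg x y) (section_mapM sm) //.
    by rewrite (section_map_triv sm e) mulg1.
  exact: section_map_sub sm _ e.
split.
- move=> x y /(lcommN _ _ _ bP) Ax /(lcommN _ _ _ bP) Ay /=.
  by rewrite gmulfM (section_mapM sm).
- apply/seteqP; split=> [_ [x /(lcommN _ _ _ bP) Ax <-] | m /= Mm].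
    exact: (section_map_mem sm).
  have [x Ax <-] := section_map_onto sm Mm.
  exists (alpha x); first exact: lcommN aP _ Ax.
  apply: phiE => //; first exact: (lcommN _ _ _ bP _ (lcommN _ _ _ aP _ Ax)).
  by apply: (agree _ (beta \o alpha)) => // y /=; rewrite bP aP.
- apply/seteqP; split=> [x [Ax /= e] | x Rx].
    have Babx := lcommR _ _ _ aP _ (section_map_ker sm (lcommN _ _ _ bP _ Ax) e).
    apply: (@eqmod_mem _ (B Q) _ _ _ (nset_subgroup (nB Q)) _ _ Babx) => //.
    by apply: (agree _ (alpha \o beta)) => // y /=; rewrite aP bP.
  have Rbx := lcommR _ _ _ bP _ Rx; split; last exact: section_map_triv sm _ Rbx.
  split; first exact: lcomm_set_subset (fp_ker_normal Q) _ Rx.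
  by apply: lcomm_setS Rx => y; rewrite /fp_ker /fp_preim /= => ->; apply: group1.
Qed.

End Presentations.

(** * Tensor powers *)

Definition epimorphic (uT xT : finGroupType) (U : {group uT}) (X : {group xT}) :=
  exists f : uT -> xT, {in U &, {morph f : x y / x * y}} /\ f @: U = X.

(** A homomorphism into an abelian group kills [[~: A, A]], hence is constant on its cosets. *)
Lemma coset_der1_eq (aT xT : finGroupType) (A : {group aT}) (X : {group xT})
    (f : aT -> xT) :
  abelian X -> {in A &, {morph f : x y / x * y}} -> {in A, forall a, f a \in X} ->
  {in A &, forall a a', coset [~: A, A] a = coset [~: A, A] a' -> f a = f a'}.
Proof.
move=> abX fM fX a a' Aa Aa'; pose g := Morphism fM.
have sK : [~: A, A] \subset 'ker g.
  rewrite gen_subG; apply/fintype.subsetP => _ /imset2P[x y Ax Ay ->].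
  apply/kerP; first exact: groupR.
  rewrite morphR //=; apply/eqP/commgP.
  by apply: (centsP abX); apply: fX.
have nA : A \subset 'N([~: A, A]) by apply: commg_norml.
move/(rcoset_kercosetP (fintype.subsetP nA _ Aa) (fintype.subsetP nA _ Aa')).
by case/rcosetP => k /(fintype.subsetP sK) kk ->; rewrite -[f]/(g : _ -> _) mkerl.
Qed.

(** [h] descends to the abelianizations, and the universal property yields a homomorphism from [T]
    whose image contains the generators of [X]. As that property speaks of additive groups, [X] is
    passed through [FiniteModule.fmod]. *)
Lemma tensor_epimorphic (aT bT uT xT : finGroupType) (A : {group aT})
    (B : {group bT}) (T : {group uT}) (X : {group xT}) (h : aT -> bT -> xT) :
  is_tensor A B T -> abelian X ->
  {in A & B, forall a b, h a b \in X} ->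
  {in A &, forall a a', {in B, forall b, h (a * a') b = h a b * h a' b}} ->
  {in B &, forall b b', {in A, forall a, h a (b * b') = h a b * h a b'}} ->
  X \subset <<[set h a b | a in A, b in B]>> ->
  epimorphic T X.
Proof.
move=> [abT [tau [tauT tauMl tauMr univ]]] abX hX hMl hMr genX.
have h_eq a a' b b' : a \in A -> a' \in A -> b \in B -> b' \in B ->
    coset [~: A, A] a = coset [~: A, A] a' -> coset [~: B, B] b = coset [~: B, B] b' ->
    h a b = h a' b'.
  move=> Aa Aa' Bb Bb' ea eb; transitivity (h a' b).
    apply: (@coset_der1_eq _ _ A X (h^~ b) abX _ _ a a') => // [x y Ax Ay | x Ax] /=.
      exact: hMl.
    exact: hX.
  apply: (@coset_der1_eq _ _ B X (h a') abX _ _ b b') => // [x y Bx By | x Bx] /=.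
    exact: hMr.
  exact: hX.
(* [k] is [h] read on pairs of cosets, with value [1] on pairs not coming from [A] and [B]. *)
have /choice[k kP] (uv : coset_of [~: A, A] * coset_of [~: B, B]) :
    exists w, {in A & B, forall a b, (coset _ a, coset _ b) = uv -> h a b = w}.
  have [[a [b [Aa Bb e]]]|no] := pselect
      (exists a b, [/\ a \in A, b \in B & (coset _ a, coset _ b) = uv]).
    by exists (h a b) => a' b' Aa' Bb'; rewrite -e => -[ea eb]; apply: h_eq.
  by exists 1 => a b Aa Bb e; case: no; exists a, b.
have kE : {in A & B, forall a b, k (coset _ a, coset _ b) = h a b}.
  by move=> a b Aa Bb; rewrite -(kP _ a b).
pose f u v := FiniteModule.fmod abX (k (u, v)).
have fmodM : {in X &, forall x y, FiniteModule.fmod abX (x * y)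
    = (FiniteModule.fmod abX x + FiniteModule.fmod abX y)%R}.
  by move=> x y Xx Xy; rewrite FiniteModule.fmodM.
have cosetM (rT : finGroupType) (H : {group rT}) :
    {in H &, {morph coset [~: H, H] : x y / x * y}}.
  by move=> x y Hx Hy; rewrite morphM // (fintype.subsetP (commg_norml H H)).
have bif : biadditive (A / [~: A, A])%G (B / [~: B, B])%G f.
  split=> _ _ /morphimP[x _ Hx ->] /morphimP[y _ Hy ->] _ /morphimP[z _ Hz ->];
    rewrite /f -cosetM // !kE ?groupM // -fmodM ?hX //.
    by rewrite hMl.
  by rewrite hMr.
have [[phi [phiM phiE]] _] := univ _ f bif.
have phiX u : FiniteModule.fmval (phi u) \in X by apply: FiniteModule.fmodP.
pose g u := FiniteModule.fmval (phi u).
have gM : {in T &, {morph g : x y / x * y}} by move=> x y Tx Ty; rewrite /g phiM.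
exists g; split=> //; apply/eqP; rewrite finset.eqEsubset; apply/andP; split.
  by apply/fintype.subsetP => _ /imsetP[u _ ->]; apply: phiX.
rewrite -[g]/(Morphism gM : _ -> _) -morphimEdom; apply: fintype.subset_trans genX _.
rewrite gen_subG; apply/fintype.subsetP => _ /imset2P[a b Aa Bb ->].
have Tt : tau (coset _ a) (coset _ b) \in T by apply: tauT; apply: mem_quotient.
apply/morphimP; exists (tau (coset _ a) (coset _ b)) => //=.
rewrite /g phiE ?mem_quotient // /f kE // FiniteModule.fmodK //; exact: hX.
Qed.

Section TensorPower.
Local Open Scope classical_set_scope.
Variables (gT : finGroupType) (G : {group gT}) (P : free_presentation G).
Variables K Z : {group gT}.
Hypotheses (nKG : K <| G) (nZG : G \subset 'N(Z)).
Local Notation L := (@fp_preim _ _ P K).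
Local Notation R := (@fp_ker _ _ P).
Hypothesis cLR : comm_set L setT `<=` R.
Hypothesis cLZ : forall i a w,
  lcomm_set L i a -> fp_map P w \in Z -> lcomm_set R i.+1 [~ a, w].

Let nL : normal_set L. Proof. exact: fp_preim_normal. Qed.
Let nR : normal_set R. Proof. exact: fp_ker_normal. Qed.

Lemma fp_ker_sub_preim (N : {group gT}) : R `<=` @fp_preim _ _ P N.
Proof. by move=> x; rewrite /fp_ker /fp_preim /= => ->; apply: group1. Qed.

Lemma fp_preim_section : section_map L R K (fp_map P).
Proof.
split=> [x y _ _| |]; first exact: gmulfM.
  apply/seteqP; split=> [_ [x Lx <-] | g /= Kg]; first exact: Lx.
  have [x px] := fp_map_onto P (fintype.subsetP (normal_sub nKG) _ Kg).
  by exists x => //; rewrite /fp_preim /= px.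
by apply/seteqP; split=> [x [_] // | x Rx]; split=> //; apply: fp_ker_sub_preim.
Qed.

Lemma fp_finite_index : finite_index setT R.
Proof. by apply: section_finite_index (fp_section P). Qed.

Let lcommL_sub i : comm_set (lcomm_set L i) setT `<=` lcomm_set R i.
Proof.
by rewrite lcomm_setSr; apply: lcomm_setS.
Qed.

(** Induction on [i]. For i = 0 the section L / R is [K] itself; afterwards an epimorphism from [U]
    onto a model of [L, _i F] / [R, _i F] is paired with G / Z by the commutator. *)
Lemma tensor_power_epimorphic i (uT : finGroupType) (T : {group uT}) :
  is_tensor_power K (G / Z)%G i T ->
  forall (xT : finGroupType) (X : {group xT}) phi,
    section_map (lcomm_set L i) (lcomm_set R i) X phi -> epimorphic T X.
Proof.
elim: i uT T => [|i IHi] uT T.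
  move=> isoKT xT X phi sm.
  have /isogP[g injg gT'] : T \isog K by rewrite isog_sym.
  have [f fP] := section_map_factor (nset_subgroup nL) fp_preim_section
    (section_mapM sm) (section_map_triv sm).
  have gK x : x \in T -> g x \in K by move=> Tx; rewrite -gT' mem_morphim.
  exists (f \o g); split=> [x y Tx Ty /=|]; first by rewrite !morphM ?gK.
  rewrite imset_comp -morphimEdom gT'; apply/setP => x; apply/imsetP/idP.
    case=> _ /(section_map_onto fp_preim_section)[y Ly <-] ->; rewrite fP //.
    exact: section_map_mem sm _ Ly.
  case/(section_map_onto sm) => y Ly <-; exists (fp_map P y); last by rewrite fP.
  exact: Ly.
case=> vT [U [tensU tensT]] xT X psi smX.
have sA := nset_subgroup (lcomm_set_normal i nL).
have sA' := nset_subgroup (lcomm_set_normal i.+1 nL).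
have nB := lcomm_set_normal i nR.
have sBA : lcomm_set R i `<=` lcomm_set L i by apply/lcomm_setS/fp_ker_sub_preim.
(* Finiteness supplies the finite model [Y] of the previous section, to which the induction
   hypothesis applies. *)
have fin : finite_index (lcomm_set L i) (lcomm_set R i).
  apply: (finite_index_lcomm i nL nR nR) fp_finite_index => //.
  exact: fp_ker_sub_preim.
have [yT [Y [phi smY]]] := finite_index_section sA nB sBA fin.
have [g [gM gY]] := IHi _ _ tensU _ _ _ smY.
have gU u : u \in U -> g u \in Y by move=> Uu; rewrite -gY imset_f.
have /choice[l lP] y : exists x, y \in Y -> lcomm_set L i x /\ phi x = y.
  have [/(section_map_onto smY)[x Ax e]|//] := boolP (y \in Y); first by exists x.
  by exists 1.
have /choice[m mP] q : exists f, q \in G / Z -> coset Z (fp_map P f) = q.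
  have [/morphimP[x _ Gx ->]|//] := boolP (q \in G / Z); last by exists 1.
  by have [f <-] := fp_map_onto P Gx; exists f.
(* Independence of the lifts: this makes the map [h] below biadditive although [l] and [m] are mere
   set-theoretic sections. *)
have psi_eq a a' f f' : lcomm_set L i a -> lcomm_set L i a' -> phi a = phi a' ->
    coset Z (fp_map P f) = coset Z (fp_map P f') -> psi [~ a, f] = psi [~ a', f'].
  move=> Aa Aa' ea ef; transitivity (psi [~ a', f]).
    apply/(section_map_eq sA' smX); try exact: comm_set_mem.
    by apply: comm_eqmodL => //; apply/(section_map_eq sA smY).
  apply/(section_map_eq sA' smX); try exact: comm_set_mem.
  apply: comm_eqmodR => //; apply: cLZ => //.
  have nZ x : fp_map P x \in 'N(Z) by apply: (fintype.subsetP nZG); apply: fp_map_mem.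
  rewrite gmulfM multiplicativeV; apply: coset_idr; first by rewrite groupM ?groupV.
  by rewrite morphM ?groupV // morphV //= ef mulVg.
have lU u : u \in U -> lcomm_set L i (l (g u)) by move/gU/lP=> [].
have lE u : u \in U -> phi (l (g u)) = g u by move/gU/lP=> [].
pose h u q := psi [~ l (g u), m q].
apply: (@tensor_epimorphic _ _ _ _ U (G / Z)%G T X h) => //; rewrite /h.
- apply: section_map_abelian sA' smX _ => x y Ax _.
  by apply: comm_set_mem => //; apply: lcommL_sub.
- move=> u q Uu Qq; apply: section_map_mem smX _ _.
  by apply: comm_set_mem => //; apply: lU.
- move=> u v Uu Uv q Qq; have Al := lU u Uu; have Av := lU v Uv.
  have Auv : lcomm_set L i (l (g u) * l (g v)) by case: sA => _ + _; apply.
  rewrite -(section_mapM smX); try exact: comm_set_mem.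
  transitivity (psi [~ l (g u) * l (g v), m q]).
    apply: psi_eq => //; first by apply: lU; rewrite groupM.
    by rewrite (section_mapM smY) // !lE ?groupM // gM.
  apply/esym/(section_map_eq sA' smX); try exact: comm_set_mem.
    by case: sA' => _ + _; apply; apply: comm_set_mem.
  exact: commMg_eqmod.
- move=> p q Qp Qq u Uu; have Al := lU u Uu.
  rewrite -(section_mapM smX); try exact: comm_set_mem.
  transitivity (psi [~ l (g u), m p * m q]).
    have nZ x : fp_map P x \in 'N(Z) by apply: (fintype.subsetP nZG); apply: fp_map_mem.
    by apply: psi_eq => //; rewrite gmulfM morphM //= (mP _ Qp) (mP _ Qq) mP // groupM.
  apply/esym/(section_map_eq sA' smX); try exact: comm_set_mem.
    by case: sA' => _ + _; apply; apply: comm_set_mem.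
  exact: commgM_eqmod.
apply/fintype.subsetP => _ /(section_map_onto smX)[y + <-].
(* The elements that [psi] sends into the span of the values of [h] form a subgroup, so only the
   generators [a, f] have to be checked. *)
set H := <<_>>; pose C := [set y | lcomm_set L i.+1 y /\ psi y \in H].
suff : comm_set (lcomm_set L i) setT `<=` C by move=> sH /sH[].
have [A'1 A'M A'V] := sA'.
apply: comm_set_min => [|a f Aa _].
  split=> [|x z [Ax Hx] [Az Hz]|x [Ax Hx]].
  - by split=> //; rewrite (section_map1 sA' smX) group1.
  - by split; [apply: A'M | rewrite (section_mapM smX) // groupM].
  - by split; [apply: A'V | rewrite (section_mapV sA' smX) // groupV].
split; first exact: comm_set_mem.
have := section_map_mem smY Aa; rewrite -gY => /imsetP[u Uu eu].
have Gq : coset Z (fp_map P f) \in G / Z by apply/mem_quotient/fp_map_mem.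
apply: mem_gen; apply/imset2P; exists u (coset Z (fp_map P f)) => //.
by apply: psi_eq => //; rewrite ?lE ?mP //; apply: lU.
Qed.

End TensorPower.

(** * Nilpotent pairs of finite groups *)

(** For an abelian group ['m] is the rank, attained as a [p]-rank for some prime [p], and [p]-ranks
    are subadditive in extensions. *)
Lemma rank_extension (gT : finGroupType) (M X : {group gT}) :
  abelian M -> X <| M -> ('m(M) <= 'm(M / X) + 'm(X))%N.
Proof.
move=> abM /andP[sXM nXM].
rewrite !grank_abelian ?quotient_abelian ?(abelianS sXM) //.
have [p _ ->] := rank_witness M; apply: (@leq_trans ('r_p(M / X) + 'r_p(X))).
  by rewrite addnC -leq_subLR; apply: p_rank_quotient.
by rewrite leq_add ?p_rank_le_rank.
Qed.

Lemma exponent_extension (gT : finGroupType) (M X : {group gT}) :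
  X <| M -> exponent M %| exponent (M / X) * exponent X.
Proof.
move=> /andP[sXM nXM]; apply/exponentP => x Mx; rewrite expgM.
have nx := fintype.subsetP nXM x Mx.
apply: expg_exponent; apply: coset_idr; first exact: groupX.
by rewrite morphX // expg_exponent // mem_quotient.
Qed.

Section FinitePair.
Variables (gT : finGroupType) (G N : {group gT}).
Hypothesis nNG : N <| G.

Lemma lcomm_normal k : lcomm N G k <| G.
Proof.
elim: k => [|k /andP[sKG nKG]] //.
by rewrite /normal /= comm_subG //= normsR ?normG.
Qed.

Lemma lcomm_sub j k : (j <= k)%N -> lcomm N G k \subset lcomm N G j.
Proof.
elim: k => [|k IHk]; first by rewrite leqn0 => /eqP->.
rewrite leq_eqVlt => /predU1P[-> // | /IHk]; apply: fintype.subset_trans.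
by rewrite /= commg_subl normal_norm // lcomm_normal.
Qed.

Definition pair_ucn_gp i : {group gT} := Group (proj1 (pair_ucn_group i nNG)).

Lemma pair_ucn_gp_normal i : pair_ucn_gp i <| G.
Proof.
rewrite /normal (proj2 (pair_ucn_group i nNG)) andbT.
case: i => [|i] /=; first exact: sub1G.
by apply/fintype.subsetP => x /setIdP[/(fintype.subsetP (normal_sub nNG))].
Qed.

(** * Preimages of the lower and upper central series of the pair *)

Section PairPresentation.
Local Open Scope classical_set_scope.
Variable P : free_presentation G.
Local Notation preim := (@fp_preim _ _ P).
Local Notation R := (@fp_ker _ _ P).
Local Notation L k := (preim (lcomm N G k)).

Let nR : normal_set R. Proof. exact: fp_ker_normal. Qed.
Let nS : normal_set (preim N). Proof. exact: fp_preim_normal. Qed.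
Let nL k : normal_set (L k). Proof. exact/fp_preim_normal/lcomm_normal. Qed.

Lemma lcomm_set_preim_map k x :
  lcomm_set (preim N) k x -> fp_map P x \in lcomm N G k.
Proof.
elim: k x => [|k IHk] x //; move: x.
apply: (comm_set_min (nset_subgroup (nL k.+1))) => x f Sx _.
by rewrite /fp_preim /= multiplicativeR mem_commg ?fp_map_mem //; apply: IHk.
Qed.

(** Generators lift because [fp_map P] maps onto [G], and the liftable elements form the subgroup
    [H]. *)
Lemma lcomm_set_preim_onto k g : g \in lcomm N G k ->
  exists2 x, lcomm_set (preim N) k x & fp_map P x = g.
Proof.
elim: k g => [|k IHk] g.
  move=> Ng; have [x px] := fp_map_onto P (fintype.subsetP (normal_sub nNG) g Ng).
  by exists x; rewrite // /fp_preim /= px.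
have nSk := lcomm_set_normal k.+1 nS.
pose H := [set g in G |
  `[<exists2 x, lcomm_set (preim N) k.+1 x & fp_map P x = g>]]%SET.
have gH : group_set H.
  apply/group_setP; split.
    rewrite inE group1; apply/asboolP; exists 1; first exact: (nset1 nSk).
    exact: multiplicative1.
  move=> u v; rewrite !inE => /andP[Gu /asboolP[x Sx <-]] /andP[Gv /asboolP[y Sy <-]].
  rewrite groupM ?fp_map_mem //; apply/asboolP; exists (x * y); last exact: gmulfM.
  exact: (nsetM nSk).
suff /fintype.subsetP sH : lcomm N G k.+1 \subset Group gH.
  by move/sH; rewrite inE => /andP[_ /asboolP].
rewrite gen_subG; apply/fintype.subsetP => _ /imset2P[_ y /IHk[x Sx <-] Gy ->].
have [f pf] := fp_map_onto P Gy; rewrite inE -pf -multiplicativeR fp_map_mem.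
by apply/asboolP; exists [~ x, f] => //; apply: comm_set_mem.
Qed.

Lemma comm_preim_lcomm k : comm_set (L k) setT `<=` L k.+1.
Proof.
apply: (comm_set_min (nset_subgroup (nL k.+1))) => x f Lx _.
by rewrite /fp_preim /= multiplicativeR mem_commg ?fp_map_mem.
Qed.

Lemma preim_trivial (H : {group gT}) : H :=: 1 -> preim H = R.
Proof.
move=> H1; apply/seteqP; split=> x; rewrite /fp_preim /fp_ker /= H1 inE.
  by move/eqP.
by move->.
Qed.

Lemma lcomm_set_pair_finite_index t c : lcomm N G t :=: 1 ->
  (* [R] will be rewritten as the preimage of [N, _t G], which gives a claim valid for every [t] and
     proved by descending the chain one term at a time. *)
  finite_index (lcomm_set (preim N) c) (lcomm_set R c).
Proof.
move=> Nt1; rewrite -(preim_trivial Nt1); elim: t {Nt1} => [|t IHt].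
  by exists [:: 1] => x Sx; exists 1; rewrite ?inE // invg1 mul1g.
apply: finite_index_trans IHt _.
apply: (@finite_index_lcomm _ _ _ R) => //.
- move=> x; apply: (fintype.subsetP (lcomm_sub (leqnSn t))).
- exact: fp_ker_sub_preim.
- exact: comm_preim_lcomm.
- exact: fp_finite_index.
Qed.

(** Each commutator with [F] moves one step down the upper central series of the pair, whose term 0
    has preimage [R]. *)
Lemma lcomm_set_preim_ucn s : lcomm_set (preim (pair_ucn_gp s)) s `<=` R.
Proof.
elim: s => [|s IHs]; first by move=> x /set1P.
rewrite -[X in lcomm_set _ X]addn1 -lcomm_set_add; apply: (subset_trans _ IHs).
apply: lcomm_setS; have nW := fp_preim_normal P (pair_ucn_gp_normal s).
apply: (comm_set_min (nset_subgroup nW)) => x f Wx _.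
have /setIdP[_ /forall_inP Zx] : fp_map P x \in pair_ucn N G s.+1 by exact: Wx.
by rewrite /fp_preim /= multiplicativeR; apply: Zx; apply: fp_map_mem.
Qed.

(** With W the preimage of Z_s(N, G), the three subgroups lemma reduces the claim to [L s,
    [W, _j F]] <= [R, _(j+1) F] for all j. *)
Lemma comm_preim_lcomm_ucn s i a w :
  lcomm_set (L s) i a -> fp_map P w \in pair_ucn_gp s -> lcomm_set R i.+1 [~ a, w].
Proof.
move=> La Ww; pose W := preim (pair_ucn_gp s).
have nW : normal_set W by apply/fp_preim_normal/pair_ucn_gp_normal.
rewrite -[X in lcomm_set R X]addn1 -lcomm_set_add -[i in lcomm_set _ i]addn0.
have nR1 := lcomm_set_normal 1 nR.
apply: (@comm_lcomm_set _ (L s) W _ (nL s) nW nR1 _ i 0%N) => // j x y Lx Wy.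
rewrite lcomm_set_add addn1; have nRj := lcomm_set_normal j.+1 nR.
have [u Su pu] := lcomm_set_preim_onto Lx.
(* Here x = r u with r in [R] and u in [S, _s F] <= gamma_(s+1)(F). The second factor [u, y] lies in
   [W, _(s+j+1) F] <= [R, _(j+1) F], because [W, _s F] <= R. *)
rewrite -(mulgVK u x) commMg_conj; apply: (nsetM nRj).
  apply: (nsetJ nRj); apply: (nset_commC nRj).
  rewrite -(addn0 j); apply: (@lcomm_set_comm _ R j 0%N) => //.
    by apply: lcomm_setS Wy.
  by rewrite /lcomm_set /= /fp_ker /= gmulfM multiplicativeV pu mulgV.
have Tu : lcomm_set setT s u by apply: lcomm_setS Su.
have := lcomm_set_comm nW Tu Wy; rewrite addnC -addSn -lcomm_set_add.
by apply: lcomm_setS; apply: lcomm_set_preim_ucn.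
Qed.

End PairPresentation.
End FinitePair.

(** * The presentation of a quotient group *)

Section QuotientPresentation.
Local Open Scope classical_set_scope.
Variables (gT : finGroupType) (G K : {group gT}) (P : free_presentation G).
Hypothesis nKG : K <| G.

Definition quotient_fp_map : fp_group P -> coset_of K := coset K \o fp_map P.

Fact quotient_fp_mapM : {morph quotient_fp_map : x y / x * y}.
Proof.
have nK x : fp_map P x \in 'N(K).
  by apply: (fintype.subsetP (normal_norm nKG)); apply: fp_map_mem.
by move=> x y; rewrite /quotient_fp_map /= gmulfM morphM.
Qed.

HB.instance Definition _ :=
  isMultiplicative.Build (fp_group P) (coset_of K) quotient_fp_map quotient_fp_mapM.

Fact quotient_fp_onto : range quotient_fp_map = [set` (G / K)%G].
Proof.
apply/seteqP; split=> [_ [x _ <-] | q] /=; first exact/mem_quotient/fp_map_mem.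
by case/morphimP=> g _ Gg ->; have [x <-] := fp_map_onto P Gg; exists x.
Qed.

(** Keeping the free group of [P] makes the multipliers of both pairs sections of one and the same
    group. *)
Definition quotient_presentation : free_presentation (G / K)%G :=
  @FreePresentation _ (G / K)%G (fp_group P) quotient_fp_map (fp_free P)
    quotient_fp_onto.

Lemma quotient_fp_ker : @fp_ker _ _ quotient_presentation = @fp_preim _ _ P K.
Proof.
apply/seteqP; split=> x; rewrite /fp_ker /fp_preim /=; last exact: coset_id.
by apply: coset_idr; apply: (fintype.subsetP (normal_norm nKG)); apply: fp_map_mem.
Qed.

Lemma quotient_fp_preim (N : {group gT}) : K \subset N ->
  @fp_preim _ _ quotient_presentation (N / K)%G = @fp_preim _ _ P N.
Proof.
move=> sKN; have nK x : fp_map P x \in 'N(K).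
  by apply: (fintype.subsetP (normal_norm nKG)); apply: fp_map_mem.
apply/seteqP; split=> x; rewrite /fp_preim /=; last exact: mem_quotient.
case/morphimP=> y ny Ny /(rcoset_kercosetP (nK x) ny)/rcosetP[k Kk ->].
by rewrite groupM // (fintype.subsetP sKN).
Qed.

End QuotientPresentation.

(** * Comparison of the two multipliers inside one finite group *)

Section Tower.
Local Open Scope classical_set_scope.

(* X <= M <= E stand for the images of [L, _c F], R :&: [S, _c F] and
   L :&: [S, _c F] modulo [R, _c F]. *)
Lemma multiplier_tower (c t : nat) (gT : finGroupType) (G N : {group gT})
    (nNG : N <| G) (P : free_presentation G) :
  (0 < c)%N -> (0 < t)%N -> lcomm N G t :=: 1 ->
  exists (hT : finGroupType) (E M X : {group hT}),
    [/\ is_multiplier P c N M /\ abelian M,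
        is_multiplier (quotient_presentation P (lcomm_normal nNG t.-1)) c
          (N / lcomm N G t.-1)%G (E / X)%G /\ abelian (E / X),
        X <| M /\ M \subset E,
        (#|lcomm N G t.-1 :&: lcomm N G c| * #|M| = #|(E / X)%G| * #|X|)%N
      & forall (uT : finGroupType) (T : {group uT}),
          is_tensor_power (lcomm N G t.-1) (G / pair_ucn N G t.-1)%G c T ->
          epimorphic T X].
Proof.
move=> hc ht Nt1.
set K := lcomm N G t.-1; set S := @fp_preim _ _ P N.
set R := @fp_ker _ _ P; set L := @fp_preim _ _ P K.
have nKG : K <| G := lcomm_normal nNG _.
have nS : normal_set S by apply: fp_preim_normal.
have nL : normal_set L by apply: fp_preim_normal.
have nR : normal_set R by apply: fp_ker_normal.
have sRS : R `<=` S by apply: fp_ker_sub_preim.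
have sRL : R `<=` L by apply: fp_ker_sub_preim.
have sKN : K \subset N by apply: (lcomm_sub nNG (leq0n _)).
have sLS : L `<=` S by move=> x; apply: (fintype.subsetP sKN).
have cLR : comm_set L setT `<=` R.
  rewrite /R -(preim_trivial P Nt1) -[in X in _ `<=` X](prednK ht).
  exact: comm_preim_lcomm.
have nSc := lcomm_set_normal c nS; have nRc := lcomm_set_normal c nR.
have nLc := lcomm_set_normal c nL.
have sRcSc : lcomm_set R c `<=` lcomm_set S c by apply: lcomm_setS.
(* Here c >= 1 enters: [L, _c F] <= [L, F] <= R. *)
have sLcR : lcomm_set L c `<=` R.
  move=> x Lx; apply: cLR; move: Lx.
  rewrite -(prednK hc) -[_.-1.+1]addn1 -lcomm_set_add.
  have nL1 := comm_set_normal nL (normal_setT _).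
  exact: lcomm_set_subset.
have nLS := normal_setI nL nSc; have nRS := normal_setI nR nSc.
have fin := lcomm_set_pair_finite_index nNG P c Nt1.
have [hT [H [phi smH]]] := finite_index_section (nset_subgroup nSc) nRc sRcSc fin.
(* All sections are images of subgroups of [S, _c F] under the single map [phi], so that the
   inclusions between them hold literally in [hT]. *)
have restr A : normal_set A -> A `<=` lcomm_set S c -> lcomm_set R c `<=` A ->
    exists E : {group hT}, section_map A (lcomm_set R c) E phi.
  move=> nA sA sR.
  have [E _] := section_map_restrict (nset_subgroup nSc) smH (nset_subgroup nA) sA.
  by rewrite setIidr //; exists E.
have sRcR : lcomm_set R c `<=` R by apply: lcomm_set_subset.
have sLcSc : lcomm_set L c `<=` lcomm_set S c by apply: lcomm_setS.
have sRcLc : lcomm_set R c `<=` lcomm_set L c by apply: lcomm_setS.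
have [E smE] : exists E : {group hT},
    section_map (L `&` lcomm_set S c) (lcomm_set R c) E phi.
  apply: restr nLS _ _ => x; first by case.
  by move=> Rx; split; [apply: sRL; apply: sRcR | apply: sRcSc].
have [M smM] : exists M : {group hT},
    section_map (R `&` lcomm_set S c) (lcomm_set R c) M phi.
  apply: restr nRS _ _ => x; first by case.
  by move=> Rx; split; [apply: sRcR | apply: sRcSc].
have [X smX] : exists X : {group hT}, section_map (lcomm_set L c) (lcomm_set R c) X phi.
  exact: restr.
have sEg := nset_subgroup nLS.
have [smEX nXE] := section_map_quotient sEg smE (nset_subgroup nLc)
  (fun x Lx => conj (sRL _ (sLcR _ Lx)) (sLcSc _ Lx)) sRcLc
  (fun x y Lx _ => nsetJ nLc y Lx) smX.
have [_ nXM] := section_map_quotient (nset_subgroup nRS) smM (nset_subgroup nLc)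
  (fun x Lx => conj (sLcR _ Lx) (sLcSc _ Lx)) sRcLc
  (fun x y Lx _ => nsetJ nLc y Lx) smX.
have [smEM nME] := section_map_quotient sEg smE (nset_subgroup nRS)
  (fun x Rx => conj (sRL _ Rx.1) Rx.2) (fun x Rx => conj (sRcR _ Rx) (sRcSc _ Rx))
  (fun x y Rx _ => nsetJ nRS y Rx) smM.
have smK : section_map (L `&` lcomm_set S c) (R `&` lcomm_set S c)
    (K :&: lcomm N G c)%G (fp_map P).
  split; first by move=> x y _ _; apply: gmulfM.
    apply/seteqP; split=> [_ [x [Lx Sx] <-] | g] /=.
      by rewrite finset.inE Lx; apply: lcomm_set_preim_map nNG _ _ _ Sx.
    rewrite finset.inE => /andP[Kg /(lcomm_set_preim_onto nNG P)[x Sx px]].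
    by exists x => //; split=> //; rewrite /L /fp_preim /= px.
  apply/seteqP; split=> [x [[Lx Sx] px] | x [Rx Sx]] //.
  by split=> //; split=> //; apply: sRL.
(* The order of [E] is counted through [M] and through [X]; by [smEM] and [smK], E / M has the order
   of K :&: [N, _c G]. *)
have cardE : (#|K :&: lcomm N G c| * #|M| = #|(E / X)%G| * #|X|)%N.
  rewrite -(section_map_card sEg smEM smK) !card_quotient ?normal_norm //.
  by rewrite ![(#|_ : _| * _)%N]mulnC !Lagrange ?normal_sub.
(* Since [S, _c F] <= gamma_(c+1)(F), its commutators with [A] fall into [A, _(c+1) F]. Taking A = R
   and A = L makes [M] and E / X abelian. *)
have cR A : normal_set A ->
    forall x y, A x -> lcomm_set S c y -> lcomm_set A c [~ x, y].
  move=> nA x y Ax Sy; have nAc := lcomm_set_normal c nA.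
  apply: (nset_commC nAc); apply: (lcomm_set_sub nA); rewrite -[c in c.+1]addn0.
  by apply: (@lcomm_set_comm _ A c 0%N) => //; apply: lcomm_setS Sy.
have abM : abelian M.
  apply: section_map_abelian (nset_subgroup nRS) smM _ => x y [Rx _] [_ Sy].
  exact: cR.
have abEX : abelian (E / X).
  by apply: section_map_abelian sEg smEX _ => x y [Lx _] [_ Sy]; apply: cR.
exists hT, E, M, X; split=> //.
- by split=> //; exists phi.
- split=> //; rewrite /is_multiplier quotient_fp_ker quotient_fp_preim //.
  by exists (coset X \o phi).
- by split=> //; apply: normal_sub.
move=> uT T tensT.
apply: (@tensor_power_epimorphic _ G P K (pair_ucn_gp nNG t.-1)) tensT _ _ _ smX => //.
  by case/andP: (pair_ucn_gp_normal nNG t.-1).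
exact: comm_preim_lcomm_ucn.
Qed.

End Tower.

(** Finiteness of both multipliers is part of the conclusion: [M] and [M'] are finite models of them
    for arbitrary presentations [P] and [P']. The number d of generators is ['m]. *)
Theorem theorem3p5 (c t : nat) (hc : (1 <= c)%N) (ht : (1 <= t)%N)
    (gT : finGroupType) (G N : {group gT}) (nNG : N <| G)
    (nil_t : nilpotent_pair_of_class N G t)
    (P : free_presentation G)
    (P' : free_presentation (G / lcomm N G t.-1)%G)
    (uT : finGroupType) (T : {group uT})
    (tensT : is_tensor_power (lcomm N G t.-1) (G / pair_ucn N G t.-1)%G c T) :
  exists (mT mT' : finGroupType) (M : {group mT}) (M' : {group mT'}),
    is_multiplier P c N M /\
    is_multiplier P' c (N / lcomm N G t.-1)%G M' /\
    ((c.+1 <= t)%N -> (#|lcomm N G t.-1| * #|M| %| #|M'| * #|T|)%N) /\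
    ((t < c.+1)%N -> (#|lcomm N G c| * #|M| %| #|M'| * #|T|)%N) /\
    ('m(M) <= 'm(M') + 'm(T))%N /\
    (exponent M <= exponent M' * exponent T)%N.
Proof.
have [Nt1 _] := nil_t.
have [hT [E [M [X [[mulM abM] [mulEX abEX] [nXM sME] cardE epiX]]]]] :=
  multiplier_tower nNG P hc ht Nt1.
have [f [fM fTX]] := epiX _ _ tensT.
pose g := Morphism fM; have gTX : g @* T = X by rewrite morphimEdom.
have abT : abelian T.
  by move: tensT hc; case: (c) => // c' /= [vT [U [_ []]]].
have sMEX : M / X \subset E / X by apply: quotientS.
exists hT, (coset_of X), M, (E / X)%G; split=> //.
(* E / X was obtained from the presentation induced by [P]; independence carries it over to [P']. *)
split; first exact: is_multiplier_indep mulEX.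
have dvX : #|X| %| #|T| by rewrite -gTX; apply: dvdn_morphim.
do !split.
- move=> lect; have sKc : lcomm N G t.-1 \subset lcomm N G c.
    by apply: lcomm_sub => //; rewrite -ltnS prednK.
  by rewrite -(finset.setIidPl sKc) cardE dvdn_pmul2l ?cardG_gt0.
(* As t <= c, the group [N, _c G] is trivial and equals its intersection with [N, _(t-1) G]. *)
- rewrite ltnS => letc; have Nc1 : lcomm N G c :=: 1.
    by apply/trivgP; rewrite -Nt1; apply: lcomm_sub.
  have e : #|lcomm N G t.-1 :&: lcomm N G c| = #|lcomm N G c|.
    by congr #|pred_of_set _|; apply/finset.setIidPr; rewrite Nc1 sub1G.
  by rewrite -e cardE dvdn_pmul2l ?cardG_gt0.
(* Passing from M / X to the larger E / X is legitimate because both are abelian, where ['m] is the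
   monotone rank. *)
- apply: leq_trans (rank_extension abM nXM) _; apply: leq_add.
    by rewrite !grank_abelian ?(abelianS sMEX) //; apply: rankS.
  by rewrite -gTX; apply: morphim_grank.
apply: dvdn_leq; first by rewrite muln_gt0 !exponent_gt0.
apply: dvdn_trans (exponent_extension nXM) _; apply: dvdn_mul; first exact: exponentS.
by rewrite -gTX; apply: exponent_morphim.
Qed.
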